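(* Let $K>0$ and $L\in\mathbb{R}\setminus\{0\}$, fix $\psi_1=0$, and put $\psi=\psi_2-\psi_1$. Suppose that $r_1,r_2\in[0,1]$ and $\psi_2\in[0,2\pi)$ are such that $(r_1,r_2,\psi_1,\psi_2)$ satisfies the four stationary self-consistency equations $$r_1=\int_0^{2\pi}\cos(\psi_1-\theta)\,p_1(\theta)\,d\theta,\qquad r_2=\int_0^{2\pi}\cos(\psi_2-\theta)\,p_2(\theta)\,d\theta,$$ $$0=\int_0^{2\pi}\sin(\psi_1-\theta)\,p_1(\theta)\,d\theta,\qquad 0=\int_0^{2\pi}\sin(\psi_2-\theta)\,p_2(\theta)\,d\theta,$$ of the symmetric two-community noisy Kuramoto model without disorder. Then either $r_1=r_2=0$, or $r_1>0$, $r_2>0$ and $\psi\in\{0,\pi\}$.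
   Context: The two-community noisy Kuramoto model with internal coupling strengths $K_1=K_2=K$, cross-community coupling strengths $L_1=L_2=L$, equal community sizes ($\alpha_1=\alpha_2=\tfrac12$), noise strength $D=1$, and natural frequency distributions $\mu_1=\mu_2=\delta_0$ (no disorder) has, in the thermodynamic limit, stationary phase densities on the circle $\mathbb{R}/2\pi\mathbb{Z}$ given by $$p_1(\theta)=\frac{\exp[Lr_2\cos(\psi_2-\theta)+Kr_1\cos(\psi_1-\theta)]}{\int_0^{2\pi}\exp[Lr_2\cos(\psi_2-\phi)+Kr_1\cos(\psi_1-\phi)]\,d\phi},$$ $$p_2(\theta)=\frac{\exp[Lr_1\cos(\psi_1-\theta)+Kr_2\cos(\psi_2-\theta)]}{\int_0^{2\pi}\exp[Lr_1\cos(\psi_1-\phi)+Kr_2\cos(\psi_2-\phi)]\,d\phi}.$$ Here $r_1,r_2\in[0,1]$ are the synchronization levels and $\psi_1,\psi_2$ the average phases of the two communities. The (stationary) order parameters of the system are the $(r_1,r_2,\psi_1,\psi_2)$ that satisfy the four self-consistency equations. *)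

(* Defs.v *)
From Stdlib Require Import Reals.
From Coquelicot Require Import Coquelicot.
Open Scope R_scope.

(* All integrands below are continuous in the angle, so the total operator
   [RInt] is the genuine Riemann integral over one period [0, 2 PI]. *)

(* Unnormalized stationary densities of the two communities. *)
Definition weight1 (K L r1 r2 psi1 psi2 theta : R) : R :=
  exp (L * r2 * cos (psi2 - theta) + K * r1 * cos (psi1 - theta)).

Definition weight2 (K L r1 r2 psi1 psi2 theta : R) : R :=
  exp (L * r1 * cos (psi1 - theta) + K * r2 * cos (psi2 - theta)).

Definition density1 (K L r1 r2 psi1 psi2 theta : R) : R :=
  weight1 K L r1 r2 psi1 psi2 theta
  / RInt (fun phi => weight1 K L r1 r2 psi1 psi2 phi) 0 (2 * PI).

Definition density2 (K L r1 r2 psi1 psi2 theta : R) : R :=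
  weight2 K L r1 r2 psi1 psi2 theta
  / RInt (fun phi => weight2 K L r1 r2 psi1 psi2 phi) 0 (2 * PI).

Definition self_consistent (K L r1 r2 psi1 psi2 : R) : Prop :=
  r1 = RInt (fun theta => cos (psi1 - theta)
              * density1 K L r1 r2 psi1 psi2 theta) 0 (2 * PI) /\
  r2 = RInt (fun theta => cos (psi2 - theta)
              * density2 K L r1 r2 psi1 psi2 theta) 0 (2 * PI) /\
  0 = RInt (fun theta => sin (psi1 - theta)
              * density1 K L r1 r2 psi1 psi2 theta) 0 (2 * PI) /\
  0 = RInt (fun theta => sin (psi2 - theta)
              * density2 K L r1 r2 psi1 psi2 theta) 0 (2 * PI).

(* Main.v *)
Require Import Defs.
From Stdlib Require Import Reals Lra.
From Coquelicot Require Import Coquelicot.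
Open Scope R_scope.

(** Each density is proportional to [exp (a cos t + b sin t)], where [t] is the
    angle measured from the average phase of its own community and
    [b = - L r' sin (psi' - psi)] comes only from the other community.  Since
    [sin t exp (a cos t)] has mean zero and [b y (exp (b y) - 1) >= 0], the sine
    moment has the sign of [b], so the phase equations force
    [L r1 sin psi = L r2 sin psi = 0].  A quarter turn yields the same for the
    cosine moment, so a community with [r = 0] forces the other one to have
    [L r' cos psi = L r' sin psi = 0], that is [r' = 0]. *)

(** Continuity keeps [g] positive on a small interval around [x], and the remaining two pieces
    contribute at least zero. Positivity at a single point is what suits an integrand that vanishes
    at the zeros of a sine. *)
Lemma RInt_pos_of_pos_at (g : R -> R) (a b x : R) :
  (forall y, continuous g y) -> (forall y, 0 <= g y) ->
  a < x < b -> 0 < g x -> 0 < RInt g a b.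
Proof.
intros Cg Pg Hx Hgx.
assert (Hint : forall u v, ex_RInt g u v)
  by (intros u v; apply (ex_RInt_continuous (V := R_CompleteNormedModule)); intros; apply Cg).
(* The tolerance is [g x] itself: a value closer than that to [g x] is positive. *)
destruct (proj1 (filterlim_locally g (g x)) (Cg x) (mkposreal _ Hgx))
  as [e He].
pose (d := Rmin (e / 2) (Rmin ((x - a) / 2) ((b - x) / 2))).
assert (Hd : 0 < d /\ d < e /\ d < x - a /\ d < b - x).
{ pose proof (cond_pos e) as Pe.
  unfold d.
  pose proof (Rmin_l (e / 2) (Rmin ((x - a) / 2) ((b - x) / 2))).
  pose proof (Rmin_r (e / 2) (Rmin ((x - a) / 2) ((b - x) / 2))).
  pose proof (Rmin_l ((x - a) / 2) ((b - x) / 2)).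
  pose proof (Rmin_r ((x - a) / 2) ((b - x) / 2)).
  split; [repeat apply Rmin_glb_lt | repeat split]; lra. }
rewrite <- (RInt_Chasles g a (x - d) b), <- (RInt_Chasles g (x - d) (x + d) b)
  by apply Hint.
assert (0 <= RInt g a (x - d)) by (apply RInt_ge_0; auto; lra).
assert (0 <= RInt g (x + d) b) by (apply RInt_ge_0; auto; lra).
assert (0 < RInt g (x - d) (x + d)).
{ apply RInt_gt_0; [lra | | intros; apply Cg].
  intros y Hy.
  assert (B : ball (g x) (g x) (g y)).
  { apply He. change (Rabs (y - x) < e). apply Rabs_def1; lra. }
  change (Rabs (g y - g x) < g x) in B.
  apply Rabs_def2 in B; lra. }
unfold plus; simpl; lra.
Qed.

Lemma mult_exp_sub_1_pos (y : R) : y <> 0 -> 0 < y * (exp y - 1).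
Proof.
intros Hy.
destruct (Rdichotomy _ _ Hy) as [H | H].
- pose proof (exp_increasing y 0 H) as E. rewrite exp_0 in E. nra.
- pose proof (exp_increasing 0 y H) as E. rewrite exp_0 in E. nra.
Qed.

Lemma continuous_trig_exp (a b c x : R) :
  continuous (fun t => exp (a * cos (c - t) + b * sin (c - t))) x.
Proof.
apply (ex_derive_continuous (V := R_NormedModule)); auto_derive; exact I.
Qed.

Lemma continuous_sin_trig_exp (a b c x : R) :
  continuous (fun t => sin (c - t) * exp (a * cos (c - t) + b * sin (c - t))) x.
Proof.
apply (ex_derive_continuous (V := R_NormedModule)); auto_derive; exact I.
Qed.

Lemma RInt_period_eq_0 (F f : R -> R) :
  (forall x, is_derive F x (f x)) -> (forall x, continuous f x) ->
  F (2 * PI) = F 0 -> RInt f 0 (2 * PI) = 0.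
Proof.
intros HF Hf Hper.
apply is_RInt_unique.
(* The first [0] is the lower bound of integration, the second the value of the integral. *)
replace 0 with (minus (F (2 * PI)) (F 0)) at 2
  by (rewrite Hper; unfold minus, plus, opp; simpl; ring).
apply (is_RInt_derive (V := R_CompleteNormedModule)); auto.
Qed.

(** The integrand has a periodic antiderivative: [exp (a * cos (c - t)) / a], or [cos (c - t)] when
    [a = 0]. The term [0 * sin (c - t)] makes this the case [b = 0] of the general sine moment. *)
Lemma RInt_sin_exp_cos (a c : R) :
  RInt (fun t => sin (c - t) * exp (a * cos (c - t) + 0 * sin (c - t)))
    0 (2 * PI) = 0.
Proof.
assert (Hcos : cos (c - 2 * PI) = cos (c - 0)).
{ rewrite !cos_minus, cos_2PI, sin_2PI, cos_0, sin_0; ring. }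
destruct (Req_dec a 0) as [-> | Ha].
- apply (RInt_period_eq_0 (fun t => cos (c - t))); auto.
  + intros x. auto_derive; [exact I |].
    replace (0 * cos (c - x) + 0 * sin (c - x)) with 0 by ring.
    rewrite exp_0; unfold Rminus; ring.
  + intros x; apply continuous_sin_trig_exp.
- apply (RInt_period_eq_0 (fun t => exp (a * cos (c - t)) / a)).
  + intros x. auto_derive; [exact I |].
    replace (a * cos (c - x) + 0 * sin (c - x)) with (a * cos (c - x)) by ring.
    unfold Rminus; field; exact Ha.
  + intros x; apply continuous_sin_trig_exp.
  + now rewrite Hcos.
Qed.

Lemma sin_moment_eq_0 (a b c : R) :
  RInt (fun t => sin (c - t) * exp (a * cos (c - t) + b * sin (c - t)))
    0 (2 * PI) = 0 -> b = 0.
Proof.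
intros H.
destruct (Req_dec b 0) as [| Hb]; [assumption | exfalso].
pose (f := fun b t => sin (c - t) * exp (a * cos (c - t) + b * sin (c - t))).
(* Both moments vanish, so [g] integrates to zero; yet [g] is a positive factor times
   [y * (exp y - 1)] with [y = b * sin (c - t)], which is positive wherever the sine is nonzero. *)
pose (g := fun t => b * (f b t - f 0 t)).
assert (Hf : forall b', ex_RInt (f b') 0 (2 * PI)).
{ intros b'; apply (ex_RInt_continuous (V := R_CompleteNormedModule)).
  intros; apply continuous_sin_trig_exp. }
assert (Hg0 : RInt g 0 (2 * PI) = 0).
{ unfold g.
  rewrite (RInt_scal (V := R_CompleteNormedModule) (fun t => f b t - f 0 t))
    by (apply (ex_RInt_minus (V := R_NormedModule)); apply Hf).
  rewrite (RInt_minus (V := R_CompleteNormedModule) (f b) (f 0)) by apply Hf.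
  unfold f; rewrite H, RInt_sin_exp_cos.
  unfold scal, minus, plus, opp; simpl; unfold mult; simpl; ring. }
assert (Hg : forall t, g t = exp (a * cos (c - t))
                * ((b * sin (c - t)) * (exp (b * sin (c - t)) - 1))).
{ intros t; unfold g, f.
  rewrite !exp_plus, Rmult_0_l, exp_0; ring. }
assert (Hpos : forall t, sin (c - t) <> 0 -> 0 < g t).
{ intros t Ht; rewrite Hg.
  apply Rmult_lt_0_compat; [apply exp_pos |].
  apply mult_exp_sub_1_pos; now apply Rmult_integral_contrapositive_currified. }
assert (Hge : forall t, 0 <= g t).
{ intros t; destruct (Req_dec (sin (c - t)) 0) as [E | E].
  - rewrite Hg, E; right; ring.
  - now left; apply Hpos. }
assert (Hc : forall t, continuous g t).
{ intros t; unfold g, f.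
  apply (ex_derive_continuous (V := R_NormedModule)); auto_derive; exact I. }
pose proof PI_RGT_0 as Hpi.
(* At [PI] and [PI / 2] the sine equals [- sin c] and [- cos c], which cannot both be zero. *)
assert (Hx : exists x, 0 < x < 2 * PI /\ sin (c - x) <> 0).
{ destruct (Req_dec (sin (c - PI)) 0) as [E | E];
    [exists (PI / 2) | exists PI]; (split; [lra |]); [| exact E].
  rewrite sin_minus, cos_PI, sin_PI in E.
  rewrite sin_minus, cos_PI2, sin_PI2.
  pose proof (sin2_cos2 c) as S; unfold Rsqr in S; nra. }
destruct Hx as [x [Hx Hsx]].
pose proof (RInt_pos_of_pos_at g 0 (2 * PI) x Hc Hge Hx (Hpos x Hsx)); lra.
Qed.

Lemma cos_moment_eq_0 (a b c : R) :
  RInt (fun t => cos (c - t) * exp (a * cos (c - t) + b * sin (c - t)))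
    0 (2 * PI) = 0 -> a = 0.
Proof.
intros H.
(* Advancing the reference angle [c] by a quarter turn sends the pair (cos, sin) to (- sin, cos), so
   the coefficients [(a, b)] become [(- b, a)]. The interval of integration stays fixed. *)
apply (sin_moment_eq_0 (- b) a (c + PI / 2)).
refine (eq_trans _ H); apply RInt_ext; intros x _.
replace (c + PI / 2 - x) with (PI / 2 - (x - c)) by ring.
rewrite sin_shift, cos_shift.
replace (x - c) with (- (c - x)) by ring.
rewrite cos_neg, sin_neg.
do 2 f_equal; ring.
Qed.

Lemma RInt_normalized_eq_0 (g w : R -> R) :
  (forall x, continuous g x) -> (forall x, continuous w x) ->
  (forall x, 0 < w x) ->
  0 = RInt (fun t => g t * (w t / RInt w 0 (2 * PI))) 0 (2 * PI) ->
  RInt (fun t => g t * w t) 0 (2 * PI) = 0.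
Proof.
intros Cg Cw Pw H.
assert (HZ : 0 < RInt w 0 (2 * PI)).
{ apply RInt_gt_0; auto. pose proof PI_RGT_0; lra. }
set (Z := RInt w 0 (2 * PI)) in *.
rewrite (RInt_ext _ (fun t => scal (/ Z) (g t * w t))) in H.
2: { intros t _; unfold scal; simpl; unfold mult, Rdiv; simpl; ring. }
rewrite (RInt_scal (V := R_CompleteNormedModule)) in H.
2: { apply (ex_RInt_continuous (V := R_CompleteNormedModule)).
     intros x _; apply (continuous_mult (K := R_AbsRing)); auto. }
change (0 = / Z * RInt (fun t => g t * w t) 0 (2 * PI)) in H.
apply eq_sym, Rmult_integral in H as [H | H]; [| exact H].
exfalso; apply (Rinv_neq_0_compat Z); [lra | exact H].
Qed.

(** Expanding [cos (psi2 - t)] around [psi1] brings the weight to the form covered by the two moment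
    lemmas. *)
Lemma weight1_polar (K L r1 r2 psi1 psi2 t : R) :
  weight1 K L r1 r2 psi1 psi2 t
  = exp ((K * r1 + L * r2 * cos (psi2 - psi1)) * cos (psi1 - t)
         + - (L * r2 * sin (psi2 - psi1)) * sin (psi1 - t)).
Proof.
unfold weight1.
replace (psi2 - t) with ((psi2 - psi1) + (psi1 - t)) by ring.
rewrite (cos_plus (psi2 - psi1)); f_equal; ring.
Qed.

Lemma continuous_weight1 (K L r1 r2 psi1 psi2 x : R) :
  continuous (weight1 K L r1 r2 psi1 psi2) x.
Proof.
eapply continuous_ext;
  [intros t; symmetry; apply weight1_polar | apply continuous_trig_exp].
Qed.

Lemma sin_equation (K L r1 r2 psi1 psi2 : R) :
  0 = RInt (fun t => sin (psi1 - t) * density1 K L r1 r2 psi1 psi2 t)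
        0 (2 * PI) ->
  L * r2 * sin (psi2 - psi1) = 0.
Proof.
intros H.
apply RInt_normalized_eq_0 in H.
- rewrite (RInt_ext _ _ _ _
    (fun t _ => f_equal (Rmult _) (weight1_polar K L r1 r2 psi1 psi2 t))) in H.
  apply sin_moment_eq_0 in H; lra.
- intros x; apply (ex_derive_continuous (V := R_NormedModule)).
  auto_derive; exact I.
- apply continuous_weight1.
- intros; apply exp_pos.
Qed.

Lemma cos_equation_0 (K L r1 r2 psi1 psi2 : R) :
  0 = RInt (fun t => cos (psi1 - t) * density1 K L r1 r2 psi1 psi2 t)
        0 (2 * PI) ->
  K * r1 + L * r2 * cos (psi2 - psi1) = 0.
Proof.
intros H.
apply RInt_normalized_eq_0 in H.
- rewrite (RInt_ext _ _ _ _
    (fun t _ => f_equal (Rmult _) (weight1_polar K L r1 r2 psi1 psi2 t))) in H.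
  apply cos_moment_eq_0 in H; exact H.
- intros x; apply (ex_derive_continuous (V := R_NormedModule)).
  auto_derive; exact I.
- apply continuous_weight1.
- intros; apply exp_pos.
Qed.

Lemma incoherence_spreads (K L r1 r2 psi1 psi2 : R) :
  L <> 0 -> r1 = 0 ->
  r1 = RInt (fun t => cos (psi1 - t) * density1 K L r1 r2 psi1 psi2 t)
        0 (2 * PI) ->
  0 = RInt (fun t => sin (psi1 - t) * density1 K L r1 r2 psi1 psi2 t)
        0 (2 * PI) ->
  r2 = 0.
Proof.
intros HL H0 Hcos Hsin.
apply sin_equation in Hsin.
(* Only the left-hand [r1] is replaced, giving a vanishing cosine moment of the unchanged
   density. *)
rewrite H0 in Hcos at 1; apply cos_equation_0 in Hcos.
rewrite H0, Rmult_0_r, Rplus_0_l in Hcos.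
pose proof (sin2_cos2 (psi2 - psi1)) as S; unfold Rsqr in S.
assert (L * r2 = 0) as E.
{ set (s := sin _) in *; set (c := cos _) in *.
  replace (L * r2) with (L * r2 * s * s + L * r2 * c * c)
    by (rewrite !Rmult_assoc, <- !Rmult_plus_distr_l, S; ring).
  rewrite Hsin, Hcos; ring. }
apply Rmult_integral in E as [E | E]; [contradiction | exact E].
Qed.

Theorem proposition3p3 (K L r1 r2 psi1 psi2 psi : R)
  (hK : 0 < K) (hL : L <> 0)
  (hpsi1 : psi1 = 0) (hpsi : psi = psi2 - psi1)
  (hr1 : 0 <= r1 <= 1) (hr2 : 0 <= r2 <= 1)
  (hpsi2 : 0 <= psi2 < 2 * PI)
  (hsc : self_consistent K L r1 r2 psi1 psi2) :
  (r1 = 0 /\ r2 = 0) \/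
  (0 < r1 /\ 0 < r2 /\ (psi = 0 \/ psi = PI)).
Proof.
destruct hsc as (Hc1 & Hc2 & Hs1 & Hs2).
(* [density2] is [density1] with the two communities exchanged. *)
change (density2 K L r1 r2 psi1 psi2)
  with (density1 K L r2 r1 psi2 psi1) in Hc2, Hs2.
destruct (Req_dec r1 0) as [E1 | E1].
{ left; split; [exact E1 |].
  exact (incoherence_spreads K L r1 r2 psi1 psi2 hL E1 Hc1 Hs1). }
destruct (Req_dec r2 0) as [E2 | E2].
{ left; split; [| exact E2].
  exact (incoherence_spreads K L r2 r1 psi2 psi1 hL E2 Hc2 Hs2). }
right; split; [lra |]; split; [lra |].
apply sin_equation in Hs1; rewrite <- hpsi in Hs1.
assert (S : sin psi = 0).
{ apply Rmult_integral in Hs1 as [E | E]; [| exact E].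
  exfalso; revert E; now apply Rmult_integral_contrapositive_currified. }
(* Since [psi1 = 0], [psi] equals [psi2]; the third root [2 * PI] is excluded by [psi2 < 2 * PI]. *)
destruct (sin_eq_O_2PI_0 psi) as [E | [E | E]]; auto; lra.
Qed.
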